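(* Fix a finite set $Q$ of states. Let $\Gamma$ be a context, $t$ a simply-typed $\lambda$-term, $\sigma$ a quantitative refined type and $\kappa$ a simple type. (1) If $\Gamma \vdash t : \sigma :: \kappa$ is derivable in the quantitative intersection type system, then $\lfloor \Gamma \rfloor \vdash t : \lfloor \sigma \rfloor :: \kappa$ is derivable in Kobayashi's intersection type system. (2) If $x_1 : \sigma_1 :: \kappa_1, \ldots, x_n : \sigma_n :: \kappa_n \vdash t : \tau :: \kappa$ is derivable in Kobayashi's intersection type system, then there exist quantitative refined types $\hat{\sigma}_1,\ldots,\hat{\sigma}_n,\hat{\tau}$ such that: $\hat{\sigma}_i :: \kappa_i$ for all $1\le i\le n$ and $\hat{\tau} :: \kappa$; $\lfloor \hat{\sigma}_i \rfloor \preccurlyeq \sigma_i$ for all $1 \le i \le n$ and $\lfloor \hat{\tau} \rfloor \preccurlyeq \tau$; and $x_1 : \hat{\sigma}_1 :: \kappa_1, \ldots, x_n : \hat{\sigma}_n :: \kappa_n \vdash t : \hat{\tau} :: \kappa$ is derivable in the quantitative intersection type system. Moreover, both translations of derivations are effective.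
   Context: Simple types: $\kappa ::= o \mid \kappa \to \kappa'$. Fix a finite set $Q$ of states. Refined pre-types: $\sigma,\tau ::= q \mid \tau \to \sigma \mid \bigwedge_{j \in J} \tau_j$ with $q \in Q$ and $J$ finite. Refinement relation $\sigma :: \kappa$: $q :: o$ for every $q\in Q$; if $\tau_j :: \kappa$ for all $j \in J$ and $\sigma :: \kappa'$ then $(\bigwedge_{j\in J}\tau_j) \to \sigma :: \kappa \to \kappa'$. A refined type is a pre-type refining some simple type. Sequents have the form $x_1:\tau_1::\kappa_1,\ldots,x_n:\tau_n::\kappa_n \vdash M : \sigma :: \kappa$ with distinct variables; terms are simply-typed $\lambda$-terms (taken in $\beta\eta$-long normal form). Kobayashi's system (qualitative): intersections are idempotent, i.e. identified up to surjective reindexing: $\bigwedge_{j\in J}\sigma_{f(j)} = \bigwedge_{i \in I}\sigma_i$ for every surjection $f : J \to I$. Rules: (Axiom) if $\tau_j :: \kappa$ for all $j\in J$ and $i \in J$, then $\Gamma, x : \bigwedge_{j\in J}\tau_j :: \kappa \vdash x : \tau_i :: \kappa$. (Application) from $\Gamma \vdash M : (\bigwedge_{j\in J}\tau_j)\to\sigma :: \kappa\to\kappa'$ and $\Gamma \vdash N : \tau_j :: \kappa$ for all $j\in J$, infer $\Gamma \vdash M N : \sigma :: \kappa'$. (Lambda) from $\Gamma, x:\bigwedge_{j\in J}\tau_j::\kappa \vdash M : \sigma :: \kappa'$ infer $\Gamma \vdash \lambda x.M : (\bigwedge_{j\in J}\tau_j)\to\sigma :: \kappa\to\kappa'$. Quantitative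 system: intersections $\bigwedge_{j\in J}\tau_j$ are formal families, not quotiented by anything (not idempotent, not even associative/commutative or stable under bijective reindexing). A refined type is linear if it is of the form $q$ or $(\bigwedge_{i}\tau_i)\to\sigma$. Rules: (Axiom) for $q\in Q$: $x : q :: o \vdash x : q :: o$. (Left $\bigwedge$) from $\Gamma, x:\tau::\kappa \vdash M:\sigma::\kappa'$ infer $\Gamma, x : \bigwedge_{j\in\{i\}}\tau_j :: \kappa \vdash M:\sigma::\kappa'$, where $i \in \mathbb{N}$ and $\tau_i = \tau$. (Right $\bigwedge$) from $\Gamma_j \vdash M : \tau_j :: \kappa$ for all $j\in J$ infer $\bigwedge_{j\in J}\Gamma_j \vdash M : \bigwedge_{j\in J}\tau_j :: \kappa$, where $\bigwedge_{j\in J}\Gamma_j$ is the componentwise intersection of the contexts. (Left $\to$) from $\Gamma_1 \vdash N : \bigwedge_{j\in J}\tau_j :: \kappa$ and $\Gamma_2, x:\sigma::\kappa' \vdash M : \alpha :: \kappa''$ with $\sigma$ linear, infer $\Gamma_1,\Gamma_2, f : (\bigwedge_{j\in J}\tau_j)\to\sigma :: \kappa\to\kappa' \vdash M[x := f\,N] : \alpha :: \kappa''$. (Right $\to$) from $\Gamma, x:\bigwedge_{j\in J}\tau_j::\kappa \vdash M:\sigma::\kappa'$ infer $\Gamma \vdash \lambda x.M : (\bigwedge_{j\in J}\tau_j)\to\sigma :: \kappa\to\kappa'$. (Weakening) if $x \notin \Gamma$, from $\Gamma\vdash M:\sigma::\kappa'$ infer $\Gamma, x : \bigwedge_{j\in\emptyset}\tau_j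 :: \kappa \vdash M:\sigma::\kappa'$. (Contraction) if $x\notin\Gamma$, from $\Gamma, y:\bigwedge_{i\in I}\tau_i::\kappa, z:\bigwedge_{j\in J}\tau_j::\kappa \vdash M:\sigma::\kappa'$ infer $\Gamma, x:\bigwedge_{k\in I\uplus J}\tau_k::\kappa \vdash M[y,z:=x]:\sigma::\kappa'$. Collapse: for a quantitative type $\sigma$, $\lfloor\sigma\rfloor$ is the qualitative type obtained by imposing stability under surjective reindexing (idempotency); extended to contexts componentwise. Order $\preccurlyeq$ on qualitative types (Scott model order): if $\sigma::o$ and $\tau::o$ then $\sigma\preccurlyeq\tau$ iff $\sigma=\tau$; and $\bigwedge_{i\in I}\sigma_i\to\tau \preccurlyeq \bigwedge_{j\in J}\sigma'_j\to\tau'$ iff both refine the same simple type $\kappa\to\kappa'$, $\tau\preccurlyeq\tau'$, and for every $i\in I$ there is $j\in J$ with $\sigma'_j \preccurlyeq \sigma_i$.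
   Formalization: The collapse also flattens nested intersections (and distributes arrows over intersection targets), since (1) fails otherwise; ≼, undefined on the intersections in contexts, is taken there as: each member of the smaller lies below some member of the larger. *)

(* Defs.v *)
(* MathComp, with finmap for contexts and indexed families. *)
From mathcomp Require Import all_boot finmap.
Set Implicit Arguments.
Unset Strict Implicit.
Unset Printing Implicit Defensive.

Local Open Scope fset_scope.
Local Open Scope fmap_scope.

Inductive sty : Type := SO | SArr of sty & sty.

(* Lambda-terms in locally nameless style: bound variables are de Bruijn
   indices, free variables are names, so that alpha-equivalence is equality
   and substituting locally closed terms for names cannot capture.  All the
   judgements below only concern locally closed terms. *)
Inductive term : Type :=
| BVar of nat
| FVar of nat
| App of term & term
| Lam of term.

Fixpoint subst (x : nat) (u t : term) : term :=
  match t with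
  | BVar i => BVar i
  | FVar y => if y == x then u else FVar y
  | App t1 t2 => App (subst x u t1) (subst x u t2)
  | Lam t1 => Lam (subst x u t1)
  end.

Fixpoint close_at (k x : nat) (t : term) : term :=
  match t with
  | BVar i => BVar i
  | FVar y => if y == x then BVar k else FVar y
  | App t1 t2 => App (close_at k x t1) (close_at k x t2)
  | Lam t1 => Lam (close_at k.+1 x t1)
  end.

(* The named abstraction "lambda x. t". *)
Definition abs (x : nat) (t : term) : term := Lam (close_at 0 x t).

Definition sctx := {fmap nat -> sty}.

Inductive styped : sctx -> term -> sty -> Prop :=
| styped_var (D : sctx) x k : D.[? x] = Some k -> styped D (FVar x) k
| styped_app (D : sctx) t u k1 k2 :
    styped D t (SArr k1 k2) -> styped D u k1 -> styped D (App t u) k2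
| styped_abs (D : sctx) x t k1 k2 :
    x \notin domf D -> styped D.[x <- k1] t k2 ->
    styped D (abs x t) (SArr k1 k2).

(* [lnf D t k]: t is a simply-typed term of type k in beta-normal eta-long
   form; [neu D t k]: t is a variable applied to such terms. *)
Inductive lnf : sctx -> term -> sty -> Prop :=
| lnf_abs (D : sctx) x t k1 k2 :
    x \notin domf D -> lnf D.[x <- k1] t k2 -> lnf D (abs x t) (SArr k1 k2)
| lnf_neu (D : sctx) t : neu D t SO -> lnf D t SO
with neu : sctx -> term -> sty -> Prop :=
| neu_var (D : sctx) x k : D.[? x] = Some k -> neu D (FVar x) k
| neu_app (D : sctx) t u k1 k2 :
    neu D t (SArr k1 k2) -> lnf D u k1 -> neu D (App t u) k2.

Section Systems.
Variable Q : finType.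

(* ---- Qualitative types ---- *)

(* The qualitative refined types of simple type k.  Families of refined types
   of type k, identified up to surjective reindexing, are finite sets of
   refined types of type k: two families have the same range iff they are
   surjective reindexings of a common family. *)
Fixpoint qual (k : sty) : finType :=
  match k with
  | SO => Q
  | SArr k1 k2 => ({set qual k1} * qual k2)%type
  end.

Definition qual_arr (k1 k2 : sty) (A : {set qual k1}) (s : qual k2) :
  qual (SArr k1 k2) := (A, s).

Fixpoint qual_le (k : sty) : rel (qual k) :=
  match k return rel (qual k) with
  | SO => fun s t => s == t
  | SArr k1 k2 => fun s t =>
      qual_le s.2 t.2 &&
      [forall i in s.1, exists j in t.1, qual_le j i]
  end.

(* The order of the Scott model on finite intersections, as sets of types:
   needed to compare the intersections that occur in contexts. *)
Definition inter_le (k : sty) (A B : {set qual k}) : bool :=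
  [forall i in A, exists j in B, qual_le i j].

(* A qualitative context maps each variable to a simple type k together with
   an intersection of refined types of type k. *)
Definition kctx := {fmap nat -> {k : sty & {set qual k}}}.

Definition kinter (k : sty) (A : {set qual k}) : {k : sty & {set qual k}} :=
  existT (fun k => {set qual k}) k A.

Definition kkinds (G : kctx) : sctx :=
  [fmap x : domf G => projT1 (G x)].

(* Derivations (in both systems) live in Type, so that a translation of
   derivations is a function. The premise [styped] says that the argument is a
   term of the right simple type, which is not implied when A is empty. *)
Inductive kder : kctx -> term -> forall k : sty, qual k -> Type :=
| k_axiom (G : kctx) x k (A : {set qual k}) (t : qual k) :
    x \notin domf G -> t \in A -> kder G.[x <- kinter A] (FVar x) t
| k_app (G : kctx) M N k1 k2 (A : {set qual k1}) (s : qual k2) :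
    kder G M (qual_arr A s) ->
    styped (kkinds G) N k1 ->
    (forall t : qual k1, t \in A -> kder G N t) ->
    kder G (App M N) s
| k_abs (G : kctx) x M k1 k2 (A : {set qual k1}) (s : qual k2) :
    x \notin domf G -> kder G.[x <- kinter A] M s ->
    kder G (abs x M) (qual_arr A s).

(* A term has an intersection type when it has all the members. *)
Definition kder_inter (G : kctx) (t : term) (k : sty) (A : {set qual k}) :=
  forall s : qual k, s \in A -> kder G t s.

(* ---- Quantitative types ---- *)

(* Pre-types; a family indexed by a finite set J of natural numbers is a finite
   map with domain J. *)
Inductive pty : Type :=
| PSt of Q
| PArr of pty & pty
| PInter of {fmap nat -> pty}.

(* The last clause is the refinement relation for the intersections which
   appear in sequents. *)
Inductive refines : pty -> sty -> Prop :=
| ref_state q : refines (PSt q) SO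
| ref_arr (T : {fmap nat -> pty}) s k1 k2 :
    (forall j : domf T, refines (T j) k1) -> refines s k2 ->
    refines (PArr (PInter T) s) (SArr k1 k2)
| ref_inter (T : {fmap nat -> pty}) k :
    (forall j : domf T, refines (T j) k) -> refines (PInter T) k.

Definition linear (s : pty) : bool :=
  match s with
  | PSt _ => true
  | PArr (PInter _) _ => true
  | _ => false
  end.

Definition qctx := {fmap nat -> pty * sty}.

Definition kinds (G : qctx) : sctx :=
  [fmap x : domf G => (G x).2].

(* The context with simple types D in which x has refined type [ty x]. *)
Definition mkctx (D : sctx) (ty : nat -> pty) : qctx :=
  [fmap x : domf D => (ty (val x), D x)].

Inductive qder : qctx -> term -> pty -> sty -> Type :=
| q_axiom x q : qder [fmap].[x <- (PSt q, SO)] (FVar x) (PSt q) SO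
| q_interL (G : qctx) x t k i M s k' :
    x \notin domf G ->
    qder G.[x <- (t, k)] M s k' ->
    qder G.[x <- (PInter [fmap].[i <- t], k)] M s k'
(* [F x j] is the type of x in the j-th context. *)
| q_interR (D : sctx) (T : {fmap nat -> pty})
    (F : nat -> domf T -> pty) M k :
    styped D M k ->
    (forall j : domf T, qder (mkctx D (fun x => F x j)) M (T j) k) ->
    qder (mkctx D (fun x => PInter [fmap j : domf T => F x j]))
         M (PInter T) k
| q_arrL (G1 G2 : qctx) N (T : {fmap nat -> pty}) k x s k' M a k'' f :
    qder G1 N (PInter T) k ->
    x \notin domf G2 ->
    qder G2.[x <- (s, k')] M a k'' ->
    linear s ->
    [disjoint domf G1 & domf G2] ->
    f \notin domf G1 -> f \notin domf G2 ->
    qder (G1 + G2).[f <- (PArr (PInter T) s, SArr k k')]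
         (subst x (App (FVar f) N) M) a k''
| q_arrR (G : qctx) x (T : {fmap nat -> pty}) k M s k' :
    x \notin domf G ->
    qder G.[x <- (PInter T, k)] M s k' ->
    qder G (abs x M) (PArr (PInter T) s) (SArr k k')
| q_weak (G : qctx) x k M s k' :
    x \notin domf G ->
    qder G M s k' ->
    qder G.[x <- (PInter [fmap], k)] M s k'
| q_contr (G : qctx) x y z (T U : {fmap nat -> pty}) k M s k' :
    y \notin domf G -> z \notin domf G -> y != z -> x \notin domf G ->
    [disjoint domf T & domf U] ->
    qder G.[y <- (PInter T, k)].[z <- (PInter U, k)] M s k' ->
    qder G.[x <- (PInter (T + U), k)]
         (subst y (FVar x) (subst z (FVar x) M)) s k'.

(* ---- Collapse ---- *)

(* Qualitative types have intersections only on the left of arrows, and no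
   nested ones. Accordingly a quantitative type s of simple type k collapses to
   the set of members of the intersection that it denotes: a singleton, if s is
   linear and has no intersection as the target of an arrow; the union of the
   collapses of the members, if s is an intersection. The set0 branches for
   states and arrows are not reached when s refines k. *)
Fixpoint collapse (s : pty) (k : sty) {struct s} : {set qual k} :=
  match s with
  | PSt q =>
      match k return {set qual k} with
      | SO => [set q]%SET
      | SArr _ _ => set0
      end
  | PArr t s' =>
      match k return {set qual k} with
      | SO => set0
      | SArr k1 k2 =>
          [set u : qual (SArr k1 k2) | u.1 == collapse t k1
                                     & u.2 \in collapse s' k2]%SET
      end
  | PInter T => \bigcup_(j : domf T) collapse (T j) k
  end.

Definition collapse_ctx (G : qctx) : kctx :=
  [fmap x : domf G => kinter (collapse (G x).1 (G x).2)].

End Systems.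

(* Main.v *)
Require Import Defs.
From mathcomp Require Import all_boot finmap.
Set Implicit Arguments.
Unset Strict Implicit.
Unset Printing Implicit Defensive.

(* (1) is an induction on quantitative derivations: after collapse, every rule
   that substitutes or renames becomes an instance of the parallel substitution
   lemma of Kobayashi's system.

   (2) is an induction on Kobayashi derivations of long normal forms. When two
   intersections are compared, each member of the first is matched with a member
   of the second: a smaller one if the intersections are to the left of an
   arrow, a larger one if they are types of context variables. The induction
   therefore separates two kinds of variables. A variable abstracted in the term
   gets quantitative types above original ones; when it is the head of a neutral
   subterm, its type is built from the types found for the arguments. A variable
   of the context gets types below original ones; when it is the head of a
   neutral subterm, it takes its arguments with empty intersections, which gives
   a type below all those with the same target. *)

Local Open Scope fset_scope.
Local Open Scope fmap_scope.

(** * Lookup in finite maps, and fresh names *)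

Section FinMaps.
Variables (K : choiceType) (V W : Type).

Lemma fmap_ext (f g : {fmap K -> V}) : (forall x, f.[? x] = g.[? x]) -> f = g.
Proof. by move=> e; apply/fmapP. Qed.

Lemma fnd_fmap_of T (A : {fset K}) (h : A -> T) x :
  [fmap y : A => h y].[? x] = omap h (insub x).
Proof.
case: insubP => [y yA <-|xNA] /=; last by rewrite not_fnd.
rewrite (in_fnd (f := [fmap y : A => h y]) (valP y)) ffunE.
by congr (Some (h _)); apply: val_inj.
Qed.

Lemma fnd_omap (f : {fmap K -> V}) (h : V -> W) x :
  [fmap y : domf f => h (f y)].[? x] = omap h f.[? x].
Proof.
rewrite fnd_fmap_of; case: insubP => [y yA <-|xNA] /=.
  by rewrite (in_fnd (valP y)) /=; congr (Some (h (f _))); apply: val_inj.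
by rewrite not_fnd.
Qed.

Lemma fnd_dom (f : {fmap K -> V}) x v : f.[? x] = Some v -> x \in domf f.
Proof. by move=> e; rewrite -fndSome e. Qed.

Lemma dom_fnd (f : {fmap K -> V}) x : x \in domf f -> {v | f.[? x] = Some v}.
Proof. by move=> xf; exists f.[xf]; rewrite in_fnd. Qed.

Lemma fnd_none (f : {fmap K -> V}) x : f.[? x] = None -> x \notin domf f.
Proof. by move=> e; rewrite -fndSome e. Qed.

Lemma fnd_setf (f : {fmap K -> V}) x v y :
  f.[x <- v].[? y] = if y == x then Some v else f.[? y].
Proof. exact: fnd_set. Qed.

End FinMaps.

Definition fresh (s : seq nat) : nat := (\max_(x <- s) x).+1.

Lemma freshP s x : x \in s -> x < fresh s.
Proof. by move=> xs; rewrite ltnS; apply: leq_bigmax_seq. Qed.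

Lemma fresh_notin s : fresh s \notin s.
Proof. by apply/negP => /freshP; rewrite ltnn. Qed.

(** * Parallel substitution *)

Fixpoint fv (t : term) : seq nat :=
  match t with
  | BVar _ => [::]
  | FVar x => [:: x]
  | App t u => fv t ++ fv u
  | Lam t => fv t
  end.

(** The common form of the cut substitution of [q_arrL], of the double renaming of contraction and
    of weakening, taken as an identity. No index is shifted under [Lam], which suits locally closed
    images. *)
Fixpoint psubst (th : nat -> term) (t : term) : term :=
  match t with
  | BVar i => BVar i
  | FVar y => th y
  | App t1 t2 => App (psubst th t1) (psubst th t2)
  | Lam t1 => Lam (psubst th t1)
  end.

Definition sub1 (x : nat) (u : term) (y : nat) : term :=
  if y == x then u else FVar y.

Definition upd (th : nat -> term) (x : nat) (u : term) (y : nat) : term :=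
  if y == x then u else th y.

Lemma subst_psubst x u t : subst x u t = psubst (sub1 x u) t.
Proof. by elim: t => //= [t1 -> t2 ->|t ->]. Qed.

Lemma psubst_comp th1 th2 t :
  psubst th1 (psubst th2 t) = psubst (fun x => psubst th1 (th2 x)) t.
Proof. by elim: t => //= [t1 -> t2 ->|t ->]. Qed.

Lemma psubst_ext th1 th2 t :
  {in fv t, th1 =1 th2} -> psubst th1 t = psubst th2 t.
Proof.
elim: t => //= [y|t1 IH1 t2 IH2|t IH] e; last by rewrite IH.
  by apply: e; rewrite inE.
by rewrite IH1 ?IH2 // => y yt; apply: e; rewrite mem_cat yt ?orbT.
Qed.

Lemma psubst_id t : psubst FVar t = t.
Proof. by elim: t => //= [t1 -> t2 ->|t ->]. Qed.

Lemma fv_close k x t : fv (close_at k x t) = [seq y <- fv t | y != x].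
Proof.
elim: t k => //= [y|t1 IH1 t2 IH2] k; first by case: eqVneq.
by rewrite IH1 IH2 filter_cat.
Qed.

Lemma close_fresh k x t : x \notin fv t -> close_at k x t = t.
Proof.
elim: t k => //= [y|t1 IH1 t2 IH2|t IH] k.
- by rewrite inE eq_sym => /negPf->.
- by rewrite mem_cat => /norP[/IH1-> /IH2->].
- by move/IH->.
Qed.

(** This is alpha-conversion: the bound [x] gets the name [z], and since [z] avoids the images of
    the other free variables, closing on [z] captures only the former occurrences of [x]. *)
Lemma psubst_close th k x z t :
  (forall y, y \in fv t -> y != x -> z \notin fv (th y)) ->
  psubst th (close_at k x t) = close_at k z (psubst (upd th x (FVar z)) t).
Proof.
elim: t k => //= [y|t1 IH1 t2 IH2|t IH] k zP; last by rewrite IH.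
  rewrite /upd; case: eqVneq => /= [_|yx]; first by rewrite eqxx.
  by rewrite close_fresh // zP // inE.
by rewrite IH1 ?IH2 // => y yt; apply: zP; rewrite mem_cat yt ?orbT.
Qed.

Fixpoint lc_at (k : nat) (t : term) : bool :=
  match t with
  | BVar i => i < k
  | FVar _ => true
  | App t u => lc_at k t && lc_at k u
  | Lam t => lc_at k.+1 t
  end.

(** Serves only to undo [close_at], up to the choice of a name. *)
Fixpoint open_at (k : nat) (u t : term) : term :=
  match t with
  | BVar i => if i == k then u else BVar i
  | FVar y => FVar y
  | App t1 t2 => App (open_at k u t1) (open_at k u t2)
  | Lam t1 => Lam (open_at k.+1 u t1)
  end.

Lemma lc_close k x t : lc_at k t -> lc_at k.+1 (close_at k x t).
Proof.
elim: t k => //= [i|y|t1 IH1 t2 IH2|t IH] k.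
- exact: ltnW.
- by case: eqVneq => /=.
- by case/andP => /IH1-> /IH2->.
- exact: IH.
Qed.

Lemma open_close k x z t :
  lc_at k t -> open_at k (FVar z) (close_at k x t) = subst x (FVar z) t.
Proof.
elim: t k => //= [i|y|t1 IH1 t2 IH2|t IH] k.
- by case: eqVneq => // ->; rewrite ltnn.
- by case: eqVneq => /=; rewrite ?eqxx.
- by case/andP => /IH1-> /IH2->.
- by move/IH->.
Qed.

Lemma subst_FVar x t : subst x (FVar x) t = t.
Proof. by elim: t => //= [y|t1 -> t2 ->|t ->] //; case: eqVneq => // ->. Qed.

(** Opening both sides with the name [x] gives back [t] on the left and a renaming of [t'] on the
    right. *)
Lemma abs_inj x t x' t' :
  lc_at 0 t -> lc_at 0 t' -> abs x t = abs x' t' -> t = subst x' (FVar x) t'.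
Proof. by move=> lt lt' [e]; rewrite -(open_close _ _ lt') -e open_close ?subst_FVar. Qed.

(** * Simple typing under substitution *)

Lemma styped_fv D t k x : styped D t k -> x \in fv t -> x \in domf D.
Proof.
elim=> {D t k} [D y k e|D t u k1 k2 _ IH1 _ IH2|D y t k1 k2 yD _ IH] /=.
- by rewrite inE => /eqP->; apply: fnd_dom e.
- by rewrite mem_cat => /orP[/IH1|/IH2].
- rewrite fv_close mem_filter => /andP[xy /IH].
  by rewrite mem_setf inE (negPf xy).
Qed.

Lemma styped_lc D t k : styped D t k -> lc_at 0 t.
Proof.
elim=> {D t k} //= [D t u k1 k2 _ -> _ -> //|D y t k1 k2 _ _].
exact: lc_close.
Qed.

(* Instantiating [P] with "being a variable of [D']" gives renaming, which is
   needed to go under binders when [P] is [styped]. *)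
Lemma styped_psubst_gen (P : sctx -> term -> sty -> Prop) :
  (forall D u k, P D u k -> styped D u k) ->
  (forall D u k z k', z \notin domf D -> P D u k -> P D.[z <- k'] u k) ->
  (forall D z k, z \notin domf D -> P D.[z <- k] (FVar z) k) ->
  forall D t k, styped D t k -> forall D' th,
    (forall y k', D.[? y] = Some k' -> P D' (th y) k') ->
    styped D' (psubst th t) k.
Proof.
move=> Pst Pw Pv D t k; elim=> {D t k}
  [D x k e|D t u k1 k2 _ IH1 _ IH2|D x t k1 k2 xD st IH] D' th thP /=.
- exact/Pst/thP.
- by apply: styped_app; [apply: IH1|apply: IH2].
- pose z := fresh (domf D'); have zD : z \notin domf D' := fresh_notin _.
  rewrite (@psubst_close _ _ _ z) => [|y yt yx].
    apply: styped_abs => //; apply: IH => y k'; rewrite fnd_setf /upd.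
    case: eqVneq => [_ [<-]|_ /thP]; [exact: Pv|exact: Pw].
  have := styped_fv st yt; rewrite mem_setf inE (negPf yx) /= => yD.
  have [k' e] := dom_fnd yD.
  by apply: contra zD; apply: styped_fv (Pst _ _ _ (thP _ _ e)).
Qed.

Definition var_in (V : Type) (D : {fmap nat -> V}) (u : term) (v : V) : Prop :=
  exists2 x, u = FVar x & D.[? x] = Some v.

Lemma var_in_weak V (D : {fmap nat -> V}) u v z w :
  z \notin domf D -> var_in D u v -> var_in D.[z <- w] u v.
Proof.
move=> zD [x -> e]; exists x => //; rewrite fnd_setf.
by case: eqVneq => // xz; rewrite -xz (fnd_dom e) in zD.
Qed.

Lemma var_in_new V (D : {fmap nat -> V}) z v : var_in D.[z <- v] (FVar z) v.
Proof. by exists z; rewrite // fnd_setf eqxx. Qed.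

(** A bound name of the derivation may be [z], which blocks a direct induction. Weakening is
    obtained instead as the identity renaming into the larger context, since substitution chooses
    bound names afresh. *)
Lemma styped_weak (D : sctx) u k z k' :
  z \notin domf D -> styped D u k -> styped D.[z <- k'] u k.
Proof.
move=> zD st; rewrite -[u]psubst_id.
apply: (styped_psubst_gen (P := @var_in _)) st _ _ _ => [D0 u0 k0 [x -> e]|||y k0 e].
- exact: styped_var.
- by move=> D0 u0 k0 z0 k1; apply: var_in_weak.
- by move=> D0 z0 k0 _; apply: var_in_new.
- by apply: var_in_weak => //; exists y.
Qed.

Lemma styped_psubst (D D' : sctx) t k th :
  (forall y k', D.[? y] = Some k' -> styped D' (th y) k') ->
  styped D t k -> styped D' (psubst th t) k.
Proof.
move=> thP st; apply: (styped_psubst_gen (P := styped)) st _ _ thP => //.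
  by move=> D0 u k0 z k1; apply: styped_weak.
by move=> D0 z k0 _; apply: styped_var; rewrite fnd_setf eqxx.
Qed.

(** * Substitution in Kobayashi's system *)

Section Kobayashi.
Variable Q : finType.
Implicit Types (G : kctx Q).

Lemma fnd_kkinds G x : (kkinds G).[? x] = omap (@projT1 _ _) G.[? x].
Proof. exact: fnd_omap. Qed.

Lemma kkinds_set G x p : kkinds G.[x <- p] = (kkinds G).[x <- projT1 p].
Proof.
apply: fmap_ext => y; rewrite fnd_kkinds !fnd_setf fnd_kkinds.
by case: eqVneq.
Qed.

Lemma kder_styped G t k (s : qual Q k) : kder G t s -> styped (kkinds G) t k.
Proof.
elim=> {G t k s} [G x k A t _ _|G M N k1 k2 A s _ IH st _ _|G x M k1 k2 A s xG _ IH].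
- by apply: styped_var; rewrite fnd_kkinds fnd_setf eqxx.
- exact: styped_app IH st.
- by apply: styped_abs => //; rewrite kkinds_set in IH.
Qed.

Lemma kder_var G x p (b : qual Q (projT1 p)) :
  G.[? x] = Some p -> b \in projT2 p -> kder G (FVar x) b.
Proof.
case: p b => k A b /= e bA.
have -> : G = G.[~ x].[x <- kinter A].
  apply: fmap_ext => y; rewrite fnd_setf fnd_rem1.
  by case: eqVneq => // ->.
by apply: k_axiom bA; rewrite mem_remf1 eqxx.
Qed.

(** The same two stages as for [styped]: with [var_in] as [P] it yields weakening, which then makes
    typability of the images an admissible [P]. Here [P] may carry derivations, so it lives in
    [Type]. *)
Lemma kder_psubst_gen
    (P : kctx Q -> term -> {k : sty & {set qual Q k}} -> Type) :
  (forall G u p, P G u p -> styped (kkinds G) u (projT1 p)) ->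
  (forall G u p b, P G u p -> b \in projT2 p -> kder G u b) ->
  (forall G u p z q, z \notin domf G -> P G u p -> P G.[z <- q] u p) ->
  (forall G z p, z \notin domf G -> P G.[z <- p] (FVar z) p) ->
  forall G t k (s : qual Q k), kder G t s -> forall G' th,
    (forall y p, G.[? y] = Some p -> P G' (th y) p) ->
    kder G' (psubst th t) s.
Proof.
move=> Pst Pk Pw Pv G t k s; elim=> {G t k s}
  [G x k A t xG tA|G M N k1 k2 A s _ IH st _ IHN|G x M k1 k2 A s xG kd IH] G' th thP /=.
- by apply: (Pk _ _ (kinter A)) => //; apply: thP; rewrite fnd_setf eqxx.
- apply: (k_app (A := A)) => [||t tA]; first exact: IH.
    apply: styped_psubst st => y k'; rewrite fnd_kkinds.
    by case e: (G.[? y]) => [p|//] [<-]; apply/Pst/thP.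
  exact: IHN.
- pose z := fresh (domf G'); have zG : z \notin domf G' := fresh_notin _.
  rewrite (@psubst_close _ _ _ z) => [|y yt yx].
    apply: k_abs => //; apply: IH => y p; rewrite fnd_setf /upd.
    case: eqVneq => [_ [<-]|_ /thP]; [exact: Pv|exact: Pw].
  have := styped_fv (kder_styped kd) yt.
  rewrite kkinds_set mem_setf inE (negPf yx) /= => yG.
  have [p e] := dom_fnd yG.
  by apply: contra zG; apply: styped_fv (Pst _ _ _ (thP _ _ e)).
Qed.

Lemma kder_weak G u k (s : qual Q k) z p :
  z \notin domf G -> kder G u s -> kder G.[z <- p] u s.
Proof.
move=> zG kd; rewrite -[u]psubst_id.
apply: (kder_psubst_gen (P := @var_in _)) kd _ _ _.
- move=> G0 u0 p0 [x -> e]; apply: styped_var.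
  by rewrite fnd_kkinds e.
- move=> G0 u0 p0 b uP bp.
  (* [var_in] is a proposition while a derivation is to be built, so the variable is read off the
     term itself. *)
  case: u0 uP => [i|x|t u1|t] uP; try by exfalso; case: uP.
  have e : G0.[? x] = Some p0 by case: uP => y [->].
  exact: kder_var e bp.
- by move=> G0 u0 p0 z0 q0; apply: var_in_weak.
- by move=> G0 z0 p0 _; apply: var_in_new.
- by move=> y p0 e; apply: var_in_weak => //; exists y.
Qed.

(** The simple typing of [th y] is a separate requirement because an empty intersection provides no
    derivation to extract it from. *)
Lemma kder_psubst G t k (s : qual Q k) G' th :
  (forall y p, G.[? y] = Some p ->
     styped (kkinds G') (th y) (projT1 p) * kder_inter G' (th y) (projT2 p)) ->
  kder G t s -> kder G' (psubst th t) s.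
Proof.
move=> thP kd.
apply: (kder_psubst_gen (P := fun G u p =>
  styped (kkinds G) u (projT1 p) * kder_inter G u (projT2 p))%type) kd _ _ thP.
- by move=> G0 u p [].
- by move=> G0 u p b [_]; apply.
- move=> G0 u p z q zG [st kd]; split=> [|b bp].
    by rewrite kkinds_set; apply: styped_weak.
  exact/kder_weak/kd.
- move=> G0 z p _; split=> [|b bp].
    by apply: styped_var; rewrite fnd_kkinds fnd_setf eqxx.
  by apply: kder_var bp; rewrite fnd_setf eqxx.
Qed.

End Kobayashi.

(** * Soundness of the collapse *)

Section Quantitative.
Variable Q : finType.
Implicit Types (G : qctx Q) (T U : {fmap nat -> pty Q}) (s t : pty Q).

Lemma fnd_mkctx D (h : nat -> pty Q) x :
  (mkctx D h).[? x] = omap (fun k => (h x, k)) D.[? x].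
Proof.
rewrite fnd_fmap_of; case: insubP => [y yA <-|xNA] /=; last by rewrite not_fnd.
by rewrite (in_fnd (valP y)) /=; congr (Some (_, D _)); apply: val_inj.
Qed.

Lemma fnd_kinds G x : (kinds G).[? x] = omap snd G.[? x].
Proof. exact: fnd_omap. Qed.

Lemma fnd_collapse_ctx G x :
  (collapse_ctx G).[? x] = omap (fun p => kinter (collapse p.1 p.2)) G.[? x].
Proof. exact: (fnd_omap G (fun p => kinter (collapse p.1 p.2))). Qed.

Lemma kinds_set G x p : kinds G.[x <- p] = (kinds G).[x <- p.2].
Proof.
by apply: fmap_ext => y; rewrite !(fnd_kinds, fnd_setf); case: eqVneq.
Qed.

Lemma kinds_mkctx D (h : nat -> pty Q) : kinds (mkctx D h) = D.
Proof.
by apply: fmap_ext => y; rewrite fnd_kinds fnd_mkctx; case: (D.[? y]).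
Qed.

Lemma kkinds_collapse G : kkinds (collapse_ctx G) = kinds G.
Proof.
apply: fmap_ext => y; rewrite fnd_kkinds fnd_collapse_ctx fnd_kinds.
by case: (G.[? y]).
Qed.

Lemma collapse_ctx_set G x p :
  collapse_ctx G.[x <- p] = (collapse_ctx G).[x <- kinter (collapse p.1 p.2)].
Proof.
by apply: fmap_ext => y; rewrite !(fnd_collapse_ctx, fnd_setf); case: eqVneq.
Qed.

Lemma collapse_interP T k (u : qual Q k) :
  reflect (exists j, exists2 t, T.[? j] = Some t & u \in collapse t k)
          (u \in collapse (PInter T) k).
Proof.
apply: (iffP bigcupP) => [[j _ uj]|[j [t e uj]]].
  by exists (val j), (T j); rewrite // Some_fnd.
have jT := fnd_dom e; move: e uj; rewrite in_fnd => -[<-] uj.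
by exists [` jT].
Qed.

Lemma refines_interP T k :
  (forall j t, T.[? j] = Some t -> refines t k) <-> refines (PInter T) k.
Proof.
split=> [TP|rT j t e].
  by apply: ref_inter => j; apply: (TP (val j)); rewrite Some_fnd.
inversion rT as [| |T' k0 TP]; subst.
by have jT := fnd_dom e; move: e; rewrite in_fnd => -[<-]; apply: TP.
Qed.

Lemma collapse_arr t s k1 k2 (A : {set qual Q k1}) (b : qual Q k2) :
  ((A, b) \in collapse (PArr t s) (SArr k1 k2)) =
  (A == collapse t k1) && (b \in collapse s k2).
Proof. by rewrite inE. Qed.

Section ContextUnion.
Variables (G1 G2 : qctx Q) (f : nat) (p : pty Q * sty).
Hypotheses (dis : [disjoint domf G1 & domf G2])
  (f1 : f \notin domf G1) (f2 : f \notin domf G2).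

Lemma fnd_catl y q : G1.[? y] = Some q -> (G1 + G2).[f <- p].[? y] = Some q.
Proof.
move=> e; have y1 := fnd_dom e; rewrite fnd_setf fnd_cat.
case: eqVneq => [yf|_]; first by move: f1; rewrite -yf y1.
by rewrite (negPf (fdisjointP dis _ y1)).
Qed.

Lemma fnd_catr y q : G2.[? y] = Some q -> (G1 + G2).[f <- p].[? y] = Some q.
Proof.
move=> e; have y2 := fnd_dom e; rewrite fnd_setf fnd_cat y2.
by case: eqVneq => // yf; move: f2; rewrite -yf y2.
Qed.

End ContextUnion.

Lemma styped_sub (D D' : sctx) (t : term) k :
  (forall y k', D.[? y] = Some k' -> D'.[? y] = Some k') ->
  styped D t k -> styped D' t k.
Proof.
move=> sub st; rewrite -[t]psubst_id; apply: styped_psubst st => y k' /sub.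
exact: styped_var.
Qed.

Lemma contr_psubst x y z (t : term) :
  subst y (FVar x) (subst z (FVar x) t) =
  psubst (fun w => FVar (if w \in [:: y; z] then x else w)) t.
Proof.
rewrite !subst_psubst psubst_comp; apply: psubst_ext => w _; rewrite !inE /sub1.
case: (eqVneq w z) => _ /=; first by rewrite orbT; case: eqP.
by rewrite orbF; case: eqP.
Qed.

Lemma qder_styped G M s k : qder G M s k -> styped (kinds G) M k.
Proof.
elim=> {G M s k} [x q|G x t k i M s k' _ _|D T F M k st _ _
  |G1 G2 N T k x s k' M a k'' f _ IHN xG2 _ IHM _ dis f1 f2
  |G x T k M s k' xG _|G x k M s k' xG _|G x y z T U k M s k' yG zG yz xG _ _].
- by apply: styped_var; rewrite fnd_kinds fnd_setf eqxx.
- by rewrite !kinds_set.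
- by rewrite kinds_mkctx.
- rewrite subst_psubst; apply: styped_psubst IHM => y k0.
  rewrite kinds_set fnd_setf /sub1; case: eqVneq => [_ [<-]|_ e].
    apply: (@styped_app _ _ _ k).
      by apply: styped_var; rewrite fnd_kinds fnd_setf eqxx.
    apply: styped_sub IHN => w k1; rewrite !fnd_kinds.
    by case e: (G1.[? w]) => [p|//] /= [<-]; rewrite (fnd_catl _ _ _ e).
  apply: styped_var; move: e; rewrite !fnd_kinds.
  by case e: (G2.[? y]) => [p|//] /= [<-]; rewrite (fnd_catr _ _ _ e).
- by rewrite kinds_set; apply: styped_abs.
- by rewrite kinds_set; apply: styped_weak.
- rewrite contr_psubst !kinds_set => IH; apply: styped_psubst IH => w k0.
  rewrite !fnd_setf !inE orbC => e; apply: styped_var; rewrite fnd_setf.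
  move: e; case: eqVneq => /= [_ <-|_]; first by rewrite eqxx.
  case: eqVneq => /= [_ <-|_]; first by rewrite eqxx.
  case: eqVneq => // ->; rewrite fnd_kinds.
  by rewrite not_fnd.
Qed.

(** The identity is a substitution from smaller to larger intersections. In the case of [q_interR]
    this moves the derivation for one member to the intersected context. *)
Lemma kder_collapse_mono (D : sctx) (h h' : nat -> pty Q) (t : term) k (s : qual Q k) :
  (forall x k', D.[? x] = Some k' -> collapse (h x) k' \subset collapse (h' x) k') ->
  kder (collapse_ctx (mkctx D h)) t s -> kder (collapse_ctx (mkctx D h')) t s.
Proof.
move=> sub kd; rewrite -[t]psubst_id; apply: kder_psubst kd => y p.
rewrite fnd_collapse_ctx fnd_mkctx; case e: (D.[? y]) => [k'|//] [<-] /=; split.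
  by apply: styped_var; rewrite kkinds_collapse kinds_mkctx.
move=> b bA; apply: (kder_var (p := kinter (collapse (h' y) k'))) => /=.
  by rewrite fnd_collapse_ctx fnd_mkctx e.
exact: (subsetP (sub _ _ e)).
Qed.

Lemma collapse_single t k i : collapse (PInter [fmap].[i <- t]) k = collapse t k.
Proof.
apply/setP => u; apply/collapse_interP/idP => [[j [t' ]]|ut].
  by rewrite fnd_setf fnd_fmap0; case: eqP => // _ [<-].
by exists i, t; rewrite // fnd_setf eqxx.
Qed.

Lemma collapse_cat T U k : [disjoint domf T & domf U] ->
  collapse (PInter (T + U)) k
  = (collapse (PInter T) k :|: collapse (PInter U) k)%SET.
Proof.
move=> dis; apply/setP => u; rewrite inE; apply/collapse_interP/orP.
  move=> [j [t]]; rewrite fnd_cat; case: ifP => _ e ut; [right|left];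
    by apply/collapse_interP; exists j, t.
case=> /collapse_interP[j [t e ut]]; exists j, t => //; rewrite fnd_cat.
  by rewrite (negPf (fdisjointP dis _ (fnd_dom e))).
by rewrite (fnd_dom e).
Qed.

Lemma kder_collapse_var G x s k (b : qual Q k) :
  G.[? x] = Some (s, k) -> b \in collapse s k -> kder (collapse_ctx G) (FVar x) b.
Proof.
move=> e; apply: (kder_var (p := kinter (collapse s k))).
by rewrite fnd_collapse_ctx e.
Qed.

Lemma qder_sound G M s k :
  qder G M s k -> kder_inter (collapse_ctx G) M (collapse s k).
Proof.
have styped_cvar G0 y p : G0.[? y] = Some p ->
    styped (kkinds (collapse_ctx G0)) (FVar y) p.2.
  by move=> e; apply: styped_var; rewrite kkinds_collapse fnd_kinds e.
elim=> {G M s k} [x q|G x t k i M s k' _ _ IH|D T F M k st _ IH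
  |G1 G2 N T k x s k' M a k'' f dN IHN xG2 _ IHM _ dis f1 f2
  |G x T k M s k' xG _ IH|G x k M s k' xG _ IH
  |G x y z T U k M s k' yG zG yz xG disTU _ IH] b.
- by apply: kder_collapse_var; rewrite fnd_setf eqxx.
- by move: (IH b); rewrite !collapse_ctx_set /fst /snd collapse_single.
(* The goal is in [Type]: [sig2W] computes an index from the propositional membership. *)
- case/bigcupP/sig2W => j _ bj; apply: kder_collapse_mono (IH j b bj) => x k' _.
  apply/subsetP => u ux; apply/collapse_interP; exists (val j), (F x j) => //.
  by rewrite fnd_fmap_of valK.
- move/IHM; rewrite subst_psubst; apply: kder_psubst => y p.
  rewrite collapse_ctx_set fnd_setf /sub1.
  set H := _.[f <- _].
  case: eqVneq => [_ [<-]|_] /=; last first.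
    rewrite fnd_collapse_ctx; case e: (G2.[? y]) => [[t k0]|//] [<-] /=.
    have eH : H.[? y] = Some (t, k0) by apply: fnd_catr.
    split; first exact: styped_cvar eH.
    by move=> c; apply: kder_collapse_var.
  have subH w q : G1.[? w] = Some q -> H.[? w] = Some q by apply: fnd_catl.
  have fH : H.[? f] = Some (PArr (PInter T) s, SArr k k').
    by rewrite fnd_setf eqxx.
  have stN : styped (kkinds (collapse_ctx H)) N k.
    rewrite kkinds_collapse; apply: styped_sub (qder_styped dN) => w k1.
    by rewrite !fnd_kinds; case e: (G1.[? w]) => [q|//] /= [<-]; rewrite (subH _ _ e).
  split; first exact: styped_app (styped_cvar _ _ _ fH) stN.
  (* Every member [c] of the collapse of [s] gives a type of [f], whose domain is the whole collapse
     of [PInter T]; the induction hypothesis on [N] covers that domain. *)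
  move=> c cs; apply: (k_app (A := collapse (PInter T) k)) => //.
    by apply: kder_collapse_var fH _; rewrite collapse_arr eqxx.
  move=> d /IHN; rewrite -{2}[N]psubst_id; apply: kder_psubst => w p0.
  rewrite fnd_collapse_ctx; case e: (G1.[? w]) => [[t k0]|//] [<-] /=.
  split; first exact: styped_cvar (subH _ _ e).
  by move=> d0; apply: kder_collapse_var (subH _ _ e).
- case: b => A b; rewrite collapse_arr => /andP[/eqP-> /IH kd].
  apply: k_abs; last by rewrite collapse_ctx_set in kd.
  by [].
- by rewrite collapse_ctx_set => /IH; apply: kder_weak.
- move/IH; rewrite contr_psubst; apply: kder_psubst => w p.
  set H := _.[x <- _].
  have xH : H.[? x] = Some (PInter (T + U), k) by rewrite fnd_setf eqxx.
  rewrite fnd_collapse_ctx !fnd_setf !inE orbC.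
  case: eqVneq => /= [_ [<-]|_]; rewrite /=.
    split; first exact: styped_cvar xH.
    move=> c cU; apply: kder_collapse_var xH _.
    by rewrite collapse_cat // inE cU orbT.
  case: eqVneq => /= [_ [<-]|_]; rewrite /=.
    split; first exact: styped_cvar xH.
    move=> c cT; apply: kder_collapse_var xH _.
    by rewrite collapse_cat // inE cT.
  case e: (G.[? w]) => [[t k0]|//] [<-] /=.
  have wH : H.[? w] = Some (t, k0).
    rewrite fnd_setf e; case: eqVneq => // wx.
    by rewrite -wx (fnd_dom e) in xG.
  split; first exact: styped_cvar wH.
  by move=> c; apply: kder_collapse_var.
Qed.

End Quantitative.

(** * Long normal forms *)

Scheme lnf_neu_ind := Induction for lnf Sort Prop
  with neu_lnf_ind := Induction for neu Sort Prop.
Combined Scheme long_ind from lnf_neu_ind, neu_lnf_ind.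

Lemma long_styped :
  (forall D t k, lnf D t k -> styped D t k) /\
  (forall D t k, neu D t k -> styped D t k).
Proof.
apply: long_ind => // [D x t k1 k2 xD _|D x k|D t u k1 k2 _ st _].
- exact: styped_abs.
- exact: styped_var.
- exact: styped_app.
Qed.

Lemma long_ren :
  (forall D t k, lnf D t k -> forall (D' : sctx) r,
     (forall y k', D.[? y] = Some k' -> D'.[? r y] = Some k') ->
     lnf D' (psubst (fun y => FVar (r y)) t) k) /\
  (forall D t k, neu D t k -> forall (D' : sctx) r,
     (forall y k', D.[? y] = Some k' -> D'.[? r y] = Some k') ->
     neu D' (psubst (fun y => FVar (r y)) t) k).
Proof.
apply: long_ind => [D x t k1 k2 xD ln IH|D t _ IH|D x k e|D t u k1 k2 _ IH1 _ IH2]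
  D' r rP /=.
- pose z := fresh (domf D'); have zD : z \notin domf D' := fresh_notin _.
  rewrite (@psubst_close _ _ _ z) => [|y yt yx].
    apply: lnf_abs => //.
    rewrite (@psubst_ext _ (fun y => FVar (if y == x then z else r y))); last first.
      by move=> y _; rewrite /upd; case: eqP.
    apply: IH => y k'; rewrite !fnd_setf.
    case: (eqVneq y x) => [_|_ /rP e]; first by rewrite eqxx.
    by case: eqVneq => // ryz; rewrite -ryz (fnd_dom e) in zD.
  have := styped_fv (long_styped.1 _ _ _ ln) yt.
  rewrite mem_setf !inE (negPf yx) /= => /dom_fnd[k' e].
  have yD := fnd_dom (rP _ _ e).
  by apply: contra zD => /eqP->.
- exact/lnf_neu/IH.
- exact/neu_var/rP.
- by apply: neu_app; [apply: IH1|apply: IH2].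
Qed.

(** The derivation of [lnf] may use another bound name than [x]; by [abs_inj] the two bodies differ
    by a renaming, which preserves long normal forms. *)
Lemma lnf_abs_inv (D : sctx) x t k1 k2 :
  x \notin domf D -> lc_at 0 t -> lnf D (abs x t) (SArr k1 k2) ->
  lnf D.[x <- k1] t k2.
Proof.
move=> xD lt ln.
have [y [u [yD lu e]]] : exists y u,
    [/\ y \notin domf D, lnf D.[y <- k1] u k2 & abs x t = abs y u].
  by inversion ln as [? y u|]; exists y, u; split; rewrite // /abs; congr Lam.
rewrite (abs_inj lt (styped_lc (long_styped.1 _ _ _ lu)) e).
rewrite subst_psubst (@psubst_ext _ (fun w => FVar (if w == y then x else w))).
  apply: long_ren.1 lu _ _ _ => w k'; rewrite !fnd_setf.
  case: (eqVneq w y) => [_|_ e']; first by rewrite eqxx.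
  by case: eqVneq => // wx; rewrite -wx (fnd_dom e') in xD.
by move=> w _; rewrite /sub1; case: eqP.
Qed.

Lemma lnf_not_lam (D : sctx) t k :
  (forall u, t <> Lam u) -> lnf D t k -> k = SO /\ neu D t SO.
Proof. by move=> tL ln; inversion ln; subst => //; case: (tL _ erefl). Qed.

(** The context fixes the type of the head variable, hence all types along the spine. So the
    argument type in a [neu] derivation is the one in the Kobayashi derivation. *)
Lemma neu_kind (D : sctx) t k k' : neu D t k -> styped D t k' -> k = k'.
Proof.
move=> ne; elim: ne k' => {D t k} [D x k e|D t u k1 k2 _ IH _] k' st.
  by inversion st as [? ? ? e'| |]; subst; move: e'; rewrite e => -[].
by inversion st as [|? ? ? k3 ? st1 _|]; subst; case: (IH _ st1).
Qed.

Lemma neu_app_inv (D : sctx) t u k1 k2 :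
  styped D t (SArr k1 k2) -> neu D (App t u) k2 ->
  neu D t (SArr k1 k2) /\ lnf D u k1.
Proof.
move=> st ne; inversion ne as [|D0 t0 u0 k0 k3 nt lu]; subst.
by case: (neu_kind nt st) => <-.
Qed.

(** * Admissible quantitative rules *)

Section ListRules.
Variable Q : finType.
Implicit Types (G : qctx Q) (T U : {fmap nat -> pty Q}) (s t : pty Q).

Lemma qder_weak_many (l : seq nat) (kf : nat -> sty) G G' M s k :
  qder G M s k -> {in l, forall v, v \notin domf G} ->
  (forall w, G'.[? w] = if w \in l then Some (PInter [fmap], kf w) else G.[? w]) ->
  qder G' M s k.
Proof.
elim: l G' => [|v l IH] G' qd lG G'P; first by rewrite (_ : G' = G) //; apply: fmap_ext.
have lG' : {in l, forall v, v \notin domf G}.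
  by move=> w wl; apply: lG; rewrite inE wl orbT.
case: (boolP (v \in l)) => vl.
  apply: IH => // w; rewrite G'P inE.
  by case: eqVneq => //= ->; rewrite vl.
have -> : G' = G'.[~ v].[v <- (PInter [fmap], kf v)].
  apply: fmap_ext => w; rewrite fnd_setf fnd_rem1 G'P inE.
  by case: eqVneq => //= ->.
apply: q_weak; first by rewrite mem_remfF.
apply: IH => // w; rewrite fnd_rem1 G'P inE.
case: eqVneq => //= ->; rewrite (negPf vl).
by rewrite not_fnd // lG // inE eqxx.
Qed.

(** Contraction onto [z] itself: [q_contr] only asks the new name to be outside [G], so it may be
    one of the two contracted names. *)
Lemma qder_merge G G' y z T U k M s k' :
  G.[? y] = Some (PInter T, k) -> G.[? z] = Some (PInter U, k) -> y != z ->
  [disjoint domf T & domf U] ->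
  (forall w, G'.[? w] = if w == z then Some (PInter (T + U), k)
                        else if w == y then None else G.[? w]) ->
  qder G M s k' -> qder G' (subst y (FVar z) M) s k'.
Proof.
move=> Gy Gz yz dis G'P qd; pose G0 := G.[~ y].[~ z].
have -> : G' = G0.[z <- (PInter (T + U), k)].
  apply: fmap_ext => w; rewrite fnd_setf !fnd_rem1 G'P.
  by case: (w == z) (w == y) => [] [].
rewrite -[X in subst y _ X](subst_FVar z).
apply: q_contr => //; rewrite ?mem_remf1 ?eqxx ?andbF //.
have <- // : G = G0.[y <- (PInter T, k)].[z <- (PInter U, k)].
apply: fmap_ext => w; rewrite !fnd_setf !fnd_rem1.
by case: (eqVneq w z) => [->|] //=; case: (eqVneq w y) => [->|].
Qed.

(** Since [q_arrL] wants disjoint contexts, a shared context has to be duplicated, and this brings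
    the copies together again. With empty [U] it also renames a context: weaken by the new names,
    then contract the old ones into them. *)
Lemma qder_merge_many (l : seq nat) (a b : nat -> nat) (kf : nat -> sty)
    (T U : nat -> {fmap nat -> pty Q}) G G' (r : nat -> term) M s k :
  uniq l -> injective a -> injective b -> 
  (forall v w, v \in l -> w \in l -> a v != b w) ->
  {in l, forall v, G.[? a v] = Some (PInter (T v), kf v)} ->
  {in l, forall v, G.[? b v] = Some (PInter (U v), kf v)} ->
  {in l, forall v, [disjoint domf (T v) & domf (U v)]} ->
  {in l, forall v, G'.[? b v] = Some (PInter (T v + U v), kf v)} ->
  {in l, forall v, G'.[? a v] = None} ->
  (forall w, w \notin map a l -> w \notin map b l -> G'.[? w] = G.[? w]) ->
  {in l, forall v, r (a v) = FVar (b v)} ->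
  (forall w, w \notin map a l -> r w = FVar w) ->
  qder G M s k -> qder G' (psubst r M) s k.
Proof.
move=> ul ia ib; elim: l ul G r M => [|v l IH] /= => [_|/andP[vl ul]] G r M
  ab Ga Gb dis G'b G'a G'o ra ro qd.
  rewrite (@psubst_ext _ FVar) ?psubst_id; last by move=> w _; apply: ro.
  by rewrite (_ : G' = G) //; apply: fmap_ext => w; apply: G'o.
have vin : v \in v :: l by rewrite inE eqxx.
have lin w : w \in l -> w \in v :: l by rewrite inE orbC => ->.
pose G1 := G.[~ a v].[b v <- (PInter (T v + U v), kf v)].
(* After the first contraction [a v] has left the context, so the remaining renaming must fix it. *)
pose r1 w := if w == a v then FVar w else r w.
have bva : b v \notin a v :: map a l.
  by apply/negP => /(mapP (s := v :: l))[w wl e]; have := ab _ _ wl vin; rewrite e eqxx.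
have G1P w : G1.[? w] = if w == b v then Some (PInter (T v + U v), kf v)
                        else if w == a v then None else G.[? w].
  by rewrite fnd_setf fnd_rem1; case: (_ == _) (_ == _) => [] [].
have qd1 : qder G1 (subst (a v) (FVar (b v)) M) s k.
  exact: qder_merge (Ga _ vin) (Gb _ vin) (ab _ _ vin vin) (dis _ vin) G1P qd.
have neq (c : nat -> nat) w : injective c -> w \in l -> (c w == c v) = false.
  by move=> ic wl; apply/negbTE; apply: contra vl => /eqP/ic<-.
have -> : psubst r M = psubst r1 (subst (a v) (FVar (b v)) M).
  rewrite subst_psubst psubst_comp; apply: psubst_ext => w _.
  rewrite /sub1 /r1; case: eqVneq => /= [->|/negPf-> //].
  rewrite ra // ro //; case: eqP => // e; by move: bva; rewrite inE e eqxx.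
apply: IH qd1 => //.
- by move=> ? ? /lin ? /lin; apply: ab.
- move=> w wl; rewrite G1P neq // Ga ?lin //.
  by rewrite (negPf (ab _ _ (lin _ wl) vin)).
- move=> w wl; rewrite G1P neq // Gb ?lin //.
  by rewrite eq_sym (negPf (ab _ _ vin (lin _ wl))).
- by move=> w /lin; apply: dis.
- by move=> w /lin; apply: G'b.
- by move=> w /lin; apply: G'a.
- move=> w wa wb; rewrite G1P; case: eqVneq => [->|wbv]; first exact: G'b.
  case: eqVneq => [->|wav]; first exact: G'a.
  by apply: G'o; rewrite inE negb_or ?wa ?wb ?wav ?wbv.
- by move=> w wl; rewrite /r1 neq // ra // lin.
- move=> w wa; rewrite /r1; case: eqVneq => // wav.
  by apply: ro; rewrite inE negb_or wav.
Qed.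

End ListRules.

(** * Application and families over a shared context *)

Section Completeness.
Variable Q : finType.
Implicit Types (D : sctx) (T U : {fmap nat -> pty Q}).

Definition ictx D (h : nat -> {fmap nat -> pty Q}) : qctx Q :=
  mkctx D (fun x => PInter (h x)).

Lemma fnd_ictx D h x : (ictx D h).[? x] = omap (fun k => (PInter (h x), k)) D.[? x].
Proof. exact: fnd_mkctx. Qed.

Lemma ictx_notin D h x : x \notin domf D -> x \notin domf (ictx D h).
Proof. by []. Qed.

Lemma ictx_set D h x k : ictx D.[x <- k] h = (ictx D h).[x <- (PInter (h x), k)].
Proof.
by apply: fmap_ext => y; rewrite !(fnd_ictx, fnd_setf); case: eqVneq => [->|].
Qed.

Lemma fnd_mkfmap (Y : Type) (A : {fset nat}) (h : nat -> Y) x :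
  [fmap y : A => h (val y)].[? x] = if x \in A then Some (h x) else None.
Proof.
by rewrite fnd_fmap_of; case: insubP => [y -> <-|/negPf->].
Qed.

(** The names in the derivation of [N] are shifted away from [D], [q_arrL] is applied, and each
    shifted name is contracted back into its original. The function variable reuses the name [x] of
    the variable that is cut. *)
Lemma qder_app D h1 h2 N T k x s k' M a k'' :
  x \notin domf D -> linear s ->
  (forall v, v \in domf D -> [disjoint domf (h1 v) & domf (h2 v)]) ->
  qder (ictx D h1) N (PInter T) k ->
  qder (ictx D h2).[x <- (s, k')] M a k'' ->
  qder (ictx D (fun v => h1 v + h2 v)).[x <- (PArr (PInter T) s, SArr k k')]
       (subst x (App (FVar x) N) M) a k''.
Proof.
move=> xD ls dis dN dM.
(* [m] exceeds [x] and all names of [D], so a name shifted by [m] is new. *)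
pose m := fresh (x :: domf D).
have Dm v : v \in domf D -> v < m by move=> vD; apply: freshP; rewrite inE vD orbT.
have xm : x < m by apply: freshP; rewrite inE eqxx.
pose A := [fset (v + m)%N | v in domf D].
have inA w : (w \in A) = (m <= w) && (w - m \in domf D).
  apply/imfsetP/andP => [[v /= vD ->]|[mw wD]]; first by rewrite addnK leq_addl.
  by exists (w - m) => //; rewrite subnK.
have mA w : w \in A -> m <= w by rewrite inA => /andP[].
pose kf v := odflt SO D.[? v].
have Dkf v : v \in domf D -> D.[? v] = Some (kf v).
  by move=> vD; rewrite /kf in_fnd.
pose W := ictx D h1 + [fmap w : A => (PInter [fmap] : pty Q, kf (val w - m))].
pose G1 : qctx Q := [fmap w : A => (PInter (h1 (val w - m)), kf (val w - m))].
have WP w : W.[? w] = if w \in A then Some (PInter [fmap], kf (w - m))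
                      else (ictx D h1).[? w].
  rewrite fnd_cat (fnd_mkfmap A (fun w => (PInter [fmap], kf (w - m)))) /=.
  by case: (w \in A).
have G1P w : G1.[? w] = if w \in A then Some (PInter (h1 (w - m)), kf (w - m))
                        else None.
  exact: (fnd_mkfmap A (fun w => (PInter (h1 (w - m)), kf (w - m)))).
have dW : qder W N (PInter T) k.
  apply: (qder_weak_many (l := A) (kf := fun w => kf (w - m)) dN) => // w /mA mw.
  by apply/negP => /Dm; rewrite ltnNge mw.
have ul : uniq (domf D) by apply: fset_uniq.
have iid : injective (@id nat) by [].
have iadd : injective (addn^~ m) by apply: addIn.
have vmA v : v \in domf D -> (v + m)%N \in A.
  by move=> vD; rewrite inA leq_addl addnK.
have vA v : v \in domf D -> (v \in A) = false.
  by move=> /Dm vm; apply/negP => /mA; rewrite leqNgt vm.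
pose r w := if w \in domf D then FVar (w + m) else FVar w.
have dN1 : qder G1 (psubst r N) (PInter T) k.
  apply: (qder_merge_many (l := domf D) (a := id) (b := addn^~ m) (kf := kf)
    (T := h1) (U := fun _ => [fmap]) ul) dW => //=.
  - by move=> v w /Dm vm _; apply: contraTneq vm => ->; rewrite -leqNgt leq_addl.
  - by move=> v vD; rewrite WP vA // fnd_ictx Dkf.
  - by move=> v vD; rewrite WP vmA // addnK.
  - by move=> v _; apply: fdisjointX0.
  - by move=> v vD; rewrite G1P vmA // addnK catf0.
  - by move=> v vD; rewrite G1P vA.
  - move=> w; rewrite map_id => wD wA; rewrite G1P WP.
    case: ifP => [|_]; last by rewrite fnd_ictx not_fnd.
    rewrite inA => /andP[mw wmD]; case/mapP: wA; exists (w - m) => //.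
    by rewrite subnK.
  - by move=> v vD; rewrite /r vD.
  - by move=> w; rewrite map_id /r => /negPf->.
have xG1 : x \notin domf G1 by apply/negP => /mA; rewrite leqNgt xm.
have disG : [disjoint domf G1 & domf (ictx D h2)].
  apply/fdisjointP => w /mA mw; apply/negP => /Dm; by rewrite ltnNge mw.
have dA := q_arrL dN1 (ictx_notin _ xD) dM ls disG xG1 (ictx_notin _ xD).
(* [r'] undoes the shift [r]. *)
pose r' w := if w \in A then FVar (w - m) else FVar w.
have -> : subst x (App (FVar x) N) M
        = psubst r' (subst x (App (FVar x) (psubst r N)) M).
  rewrite !subst_psubst psubst_comp; apply: psubst_ext => w wM.
  have xA : (x \in A) = false by apply/negP => /mA; rewrite leqNgt xm.
  rewrite /sub1; case: eqVneq => [_|wx] /=.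
    rewrite {1}/r' xA psubst_comp; congr App; rewrite -[LHS]psubst_id.
    apply: psubst_ext => v vN.
    have := styped_fv (qder_styped dN) vN; rewrite kinds_mkctx => vD.
    by rewrite /r vD /= /r' vmA // addnK.
  have := styped_fv (qder_styped dM) wM.
  rewrite kinds_set kinds_mkctx mem_setf inE (negPf wx) /= => wD.
  by rewrite /r' vA.
set R := (X in qder X).
have RP w : R.[? w] = if w == x then Some (PArr (PInter T) s, SArr k k')
    else omap (fun k => (PInter (h1 w + h2 w), k)) D.[? w].
  by rewrite fnd_setf fnd_ictx.
clearbody R.
apply: (qder_merge_many (l := domf D) (a := addn^~ m) (b := id) (kf := kf)
    (T := h1) (U := h2) ul) dA => //=.
- by move=> v w _ /Dm wm; apply: contraTneq wm => <-; rewrite -leqNgt leq_addl.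
- by move=> v vD; apply: fnd_catl => //; rewrite G1P vmA // addnK.
- by move=> v vD; apply: fnd_catr => //; rewrite fnd_ictx Dkf.
- move=> v vD; rewrite RP Dkf //.
  by case: eqVneq => // vx; rewrite -vx vD in xD.
- move=> v vD; rewrite RP not_fnd.
    by case: eqVneq => // vx; move: xm; rewrite -vx ltnNge leq_addl.
  by apply/negP => /Dm; rewrite ltnNge leq_addl.
- move=> w wA; rewrite map_id => wD; rewrite RP fnd_setf; case: eqVneq => // _.
  rewrite not_fnd // fnd_cat fnd_ictx [_ \in _]/= (negPf wD).
  rewrite G1P; case: ifP => //; rewrite inA => /andP[mw wmD].
  by case/mapP: wA; exists (w - m) => //; rewrite subnK.
- by move=> v vD; rewrite /r' vmA // addnK.
- move=> w wA; rewrite /r'; case: ifP => //; rewrite inA => /andP[mw wmD].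
  by case/mapP: wA; exists (w - m) => //; rewrite subnK.
Qed.

(** The indices start at an arbitrary [b], so that the families can be kept disjoint from earlier
    ones, as contraction requires. *)
Lemma qder_family D N k n (b : nat) (g : 'I_n -> nat -> {fmap nat -> pty Q})
    (ty : 'I_n -> pty Q) :
  styped D N k -> (forall i, qder (ictx D (g i)) N (ty i) k) ->
  {T : {fmap nat -> pty Q} & {h : nat -> {fmap nat -> pty Q} &
    ((forall j t, T.[? j] = Some t <-> exists2 i : 'I_n, j = (b + i)%N & t = ty i) /\
     (forall v j t, (h v).[? j] = Some t <->
        exists2 i : 'I_n, j = (b + i)%N & t = PInter (g i v))) *
    qder (ictx D h) N (PInter T) k}}%type.
Proof.
move=> stN dN.
pose A := [fset (b + i)%N | i in iota 0 n].
have inA j : (j \in A) = (b <= j) && (j - b < n).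
  apply/imfsetP/andP => [[i /= + ->]|[bj jn]].
    by rewrite mem_iota leq_addr addKn.
  by exists (j - b)%N; rewrite /= ?mem_iota // subnKC.
(* The default is not reached for [j] in [A], where [j - b < n]. *)
pose tyN j := if insub (j - b) is Some i then ty i else PInter [fmap].
pose gN j v := if insub (j - b) is Some i then PInter (g i v) else PInter [fmap].
pose T : {fmap nat -> pty Q} := [fmap j : A => tyN (val j)].
pose F v (j : domf T) := gN (val j) v.
have famP (e : 'I_n -> pty Q) j t :
    (if j \in A then Some (if insub (j - b) is Some i then e i else PInter [fmap])
     else None) = Some t <-> exists2 i : 'I_n, j = (b + i)%N & t = e i.
  rewrite inA; split=> [|[i -> ->]].
    case: ifP => // /andP[bj jn]; rewrite insubT => -[<-].
    by exists (Sub (j - b) jn) => //=; rewrite subnKC.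
  by rewrite leq_addr addKn ltn_ord valK.
exists T, (fun v => [fmap j : domf T => F v j]); split.
  split=> [j t|v j t].
    by rewrite (fnd_mkfmap A tyN); apply: (famP ty).
  by rewrite (fnd_mkfmap A (gN ^~ v)); apply: (famP (fun i => PInter (g i v))).
apply: (q_interR (F := F) stN) => j.
have : val j \in A by apply: valP.
rewrite inA => /andP[bj jn].
have -> : T j = ty (Sub (val j - b) jn) by rewrite ffunE /tyN insubT.
have -> : mkctx D (fun x => F x j) = ictx D (g (Sub (val j - b) jn)).
  by apply: fmap_ext => w; rewrite fnd_ictx fnd_mkctx /F /gN insubT.
exact: dN.
Qed.

(** * Lifting Kobayashi derivations *)

Lemma refines_cat T U k : refines (PInter T) k -> refines (PInter U) k ->
  refines (PInter (T + U)) k.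
Proof.
move=> /refines_interP rT /refines_interP rU; apply/refines_interP => j t.
by rewrite fnd_cat; case: ifP => _; [apply: rU|apply: rT].
Qed.

Lemma qual_le_refl k (s : qual Q k) : qual_le s s.
Proof.
elim: k s => [|k1 IH1 k2 IH2] s /=; first exact: eqxx.
by rewrite IH2; apply/forall_inP => i si; apply/exists_inP; exists i.
Qed.

(* [up] tells which way members are compared: a bound variable of the term
   occurs to the left of an arrow in the type of the term, where the order asks
   for members of [C] that lie above members of [A]. *)
Definition bounded (up : bool) k (C A : {set qual Q k}) : Prop :=
  forall i, i \in C -> exists2 j, j \in A & if up then qual_le j i else qual_le i j.

Definition ctx_bounded (B : pred nat) (G : kctx Q) h : Prop :=
  forall x p, G.[? x] = Some p ->
    refines (PInter (h x)) (projT1 p) /\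
    bounded (B x) (collapse (PInter (h x)) (projT1 p)) (projT2 p).

Definition approx k (s : qual Q k) (t : pty Q) : Prop :=
  [/\ refines t k, linear t &
      exists2 s', collapse t k = [set s']%SET & qual_le s' s].

(** [B] marks the variables abstracted in the surrounding term. It is quantified inside because
    going under an abstraction enlarges it. *)
Definition lifts (G : kctx Q) t k (s : qual Q k) : Type :=
  forall B, {h : nat -> {fmap nat -> pty Q} & {hs : pty Q &
    (ctx_bounded B G h * approx s hs * qder (ictx (kkinds G) h) t hs k)%type}}.

Lemma ctx_bounded_cat B G h1 h2 :
  (forall v, v \in domf G -> [disjoint domf (h1 v) & domf (h2 v)]) ->
  ctx_bounded B G h1 -> ctx_bounded B G h2 ->
  ctx_bounded B G (fun v => h1 v + h2 v).
Proof.
move=> dis b1 b2 x p e; have [r1 c1] := b1 _ _ e; have [r2 c2] := b2 _ _ e.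
split; first exact: refines_cat.
by rewrite collapse_cat ?dis ?(fnd_dom e) // => i; rewrite inE => /orP[/c1|/c2].
Qed.

(** The lifted derivations, one per member of [A], are assembled by [q_interR]. The first matching
    serves an abstracted head; the second shows that the collapse is empty when [A] is. *)
Lemma lifts_args (G : kctx Q) N k (A : {set qual Q k}) B b :
  styped (kkinds G) N k -> (forall s, s \in A -> lifts G N s) ->
  {T : {fmap nat -> pty Q} & {h : nat -> {fmap nat -> pty Q} &
    ([/\ ctx_bounded B G h,
         forall v j, j \in domf (h v) -> b <= j < (b + #|A|)%N,
         refines (PInter T) k,
         forall a, a \in A -> exists2 c, c \in collapse (PInter T) k & qual_le c a
       & forall c, c \in collapse (PInter T) k -> exists2 a, a \in A & qual_le c a] *
     qder (ictx (kkinds G) h) N (PInter T) k)%type}}.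
Proof.
move=> stN L; pose res (i : 'I_#|A|) := L (enum_val i) (enum_valP i) B.
have [|T [h [[TP hP] dN]]] := @qder_family (kkinds G) N k #|A| b
  (fun i => projT1 (res i)) (fun i => projT1 (projT2 (res i))) stN.
  by move=> i; case: (projT2 (projT2 (res i))).
have resP i := (projT2 (projT2 (res i))).1.
exists T, h; split=> //; split.
- move=> x p e; split.
    apply/refines_interP => j t /hP[i _ ->].
    by case: (resP i) => /(_ _ _ e)[].
  move=> u /collapse_interP[j [t /hP[i _ ->]]].
  by case: (resP i) => /(_ _ _ e)[_ +] _; apply.
- move=> v j jh; have [t /hP[i -> _]] := dom_fnd jh.
  by rewrite leq_addr ltn_add2l ltn_ord.
- by apply/refines_interP => j t /TP[i _ ->]; case: (resP i) => _ [].
- move=> a aA; pose i := enum_rank_in aA a.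
  case: (resP i) => _ [_ _ [s' e le]]; exists s'.
    apply/collapse_interP; exists (b + i)%N, (projT1 (projT2 (res i))).
      by apply/TP; exists i.
    by rewrite e inE.
  by rewrite enum_rankK_in in le.
- move=> c /collapse_interP[j [t /TP[i _ ->]]].
  case: (resP i) => _ [_ _ [s' -> le]]; rewrite inE => /eqP->.
  by exists (enum_val i); first exact: enum_valP.
Qed.

Fixpoint head (t : term) : nat :=
  match t with
  | App t _ => head t
  | FVar x => x
  | _ => 0
  end.

(* A neutral term is cut against a derivation that consumes its type, since the
   rules build an application spine from its last argument to its head. *)
Definition lifts_cut (G : kctx Q) t k (s : qual Q k) : Type :=
  forall B ty c x b h M a k'',
    refines ty k -> linear ty -> collapse ty k = [set c]%SET ->
    (if B (head t) then qual_le s c else qual_le c s) ->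
    x \notin domf G -> (forall v j, j \in domf (h v) -> j < b) ->
    ctx_bounded B G h ->
    qder (ictx (kkinds G) h).[x <- (ty, k)] M a k'' ->
    {h' : nat -> {fmap nat -> pty Q} &
      (ctx_bounded B G h' * qder (ictx (kkinds G) h') (subst x t M) a k'')%type}.

(** At base type, the axiom on a fresh variable is a derivation to cut against. In long normal form
    a neutral term is lifted at no other type. *)
Lemma lifts_of_cut (G : kctx Q) t (s : qual Q SO) : lifts_cut G t s -> lifts G t s.
Proof.
move=> cut B; pose x := fresh (domf G).
have xG : x \notin domf G := fresh_notin _.
pose h0 : nat -> {fmap nat -> pty Q} := fun _ => [fmap].
have [||//||||||h [hP d]] :=
    @cut B (PSt s) s x 0 h0 (FVar x) (PSt s) SO.
- exact: ref_state.
- by [].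
- by case: ifP => _; apply: qual_le_refl.
- by [].
- by move=> v j; rewrite domf0.
- move=> y p _; split; first by apply/refines_interP => j t0; rewrite fnd_fmap0.
  by move=> i /collapse_interP[j [t0]]; rewrite fnd_fmap0.
- apply: (qder_weak_many (l := domf G) (kf := fun v => odflt SO (kkinds G).[? v])
    (q_axiom x s)) => [v vG|w].
    apply: fnd_none; rewrite fnd_setf fnd_fmap0.
    by case: eqVneq => // vx; rewrite -vx vG in xG.
  rewrite !fnd_setf fnd_ictx fnd_fmap0.
  case: eqVneq => [->|_]; first by rewrite (negPf xG).
  by rewrite fnd_kkinds; case: fndP => // /negPf->.
exists h, (PSt s); split; last by rewrite /= eqxx in d.
split=> //; split=> //; first exact: ref_state.
by exists s; rewrite ?qual_le_refl.
Qed.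

(** At the end of the spine, the type demanded by the cut becomes one more member of the
    intersection of [y], by Left [/\] and a contraction. The comparison of [s] with [c] is what
    [bounded] asks of this member. *)
Lemma lifts_cut_var (G : kctx Q) y k (A : {set qual Q k}) s :
  G.[? y] = Some (kinter A) -> s \in A -> lifts_cut G (FVar y) s.
Proof.
move=> e sA B ty c x b h M a k'' rt lt ct cs xG hb hP d.
have yG := fnd_dom e.
(* All indices in [h] are below [b], so [b] is free for the new member. *)
pose S : {fmap nat -> pty Q} := [fmap].[b <- ty].
have dis : [disjoint domf S & domf (h y)].
  apply/fdisjointP => j jS; have -> : j = b.
    apply: contraTeq jS => jb; apply: fnd_none.
    by rewrite fnd_setf (negPf jb) fnd_fmap0.
  by apply/negP => /hb; rewrite ltnn.
exists (fun v => if v == y then S + h v else h v); split.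
  move=> v p ep; case: eqP => [vy|_]; last exact: hP.
  move: ep; rewrite vy e => -[<-]; have [ry cy] := hP _ _ e; split.
    apply: refines_cat => //; apply/refines_interP => j t.
    by rewrite fnd_setf fnd_fmap0; case: eqP => // _ [<-].
  rewrite collapse_cat // collapse_single /= ct => i; rewrite inE => /orP[|/cy //].
  by rewrite inE => /eqP->; exists s.
have xy : x != y by apply: contraNneq xG => ->.
have ky : (kkinds G).[? y] = Some k by rewrite fnd_kkinds e.
apply: (@qder_merge _ (ictx (kkinds G) h).[x <- (PInter S, k)] _ x y S (h y) k) => //.
- by rewrite fnd_setf eqxx.
- by rewrite fnd_setf eq_sym (negPf xy) fnd_ictx ky.
- move=> w; rewrite fnd_setf !fnd_ictx.
  case: (eqVneq w y) => [->|_]; first by rewrite ky.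
  by case: eqVneq => // ->; rewrite fnd_kkinds not_fnd.
- exact: q_interL.
Qed.

(** A demand [ty] on [M N] becomes the demand [PArr (PInter T) ty] on [M], where [T] gathers the
    types found for [N]. The head is unchanged, and so is the direction of comparison. *)
Lemma lifts_cut_app (G : kctx Q) M N k1 k2 (A : {set qual Q k1}) (s : qual Q k2) :
  styped (kkinds G) N k1 -> lifts_cut G M (qual_arr A s) ->
  (forall t, t \in A -> lifts G N t) -> lifts_cut G (App M N) s.
Proof.
move=> stN cutM LN B ty c x b h P a k'' rt lt ct cs xG hb hP d.
(* For a free head the empty intersection is below every other. *)
pose A' := if B (head M) then A else set0.
have LN' t : t \in A' -> lifts G N t.
  by rewrite /A'; case: (B _) => [/LN //|]; rewrite inE.
have [T [h1 [[h1P h1b rT TA AT] dN]]] := lifts_args B b stN LN'.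
have dis v : [disjoint domf (h1 v) & domf (h v)].
  apply/fdisjointP => j /h1b/andP[bj _]; apply/negP => /hb.
  by rewrite ltnNge bj.
pose h2 v := h1 v + h v.
(* The argument used the indices from [b] on, one per member of [A'], so [b + #|A'|] is the next
   bound. *)
have [||||||||h' [h'P d']] := @cutM B (PArr (PInter T) ty)
  (collapse (PInter T) k1, c) x (b + #|A'|)%N h2 (subst x (App (FVar x) N) P) a k''.
- by apply: ref_arr => //; inversion rT.
- by [].
- apply/setP => -[C e]; rewrite collapse_arr ct !inE.
  by rewrite xpair_eqE.
- move: cs; rewrite /A' /=; case: ifP => BM /= cs.
    rewrite cs; apply/forall_inP => i iA; apply/exists_inP.
    by case: (TA i); rewrite /A' ?BM // => c' c'T le; exists c'.
  rewrite cs; apply/forall_inP => i /AT[a0].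
  by rewrite /A' BM inE.
- by [].
- move=> v j; rewrite mem_catf => /orP[/h1b/andP[] //|/hb jb].
  exact: leq_trans jb (leq_addr _ _).
- exact: ctx_bounded_cat.
- exact: qder_app (fun v _ => dis v) dN d.
exists h'; split=> //; move: d'; rewrite !subst_psubst psubst_comp.
set t1 := psubst _ P; set t2 := psubst _ P; have -> // : t1 = t2.
(* [x] is not free in [N], so reusing it for the function variable is harmless. *)
apply: psubst_ext => w _; rewrite /sub1; case: eqVneq => [_|/negPf wx] /=.
  rewrite eqxx -[N in RHS]psubst_id; congr App; apply: psubst_ext => v vN.
  by case: eqVneq => // vx; rewrite -vx (styped_fv stN vN) in xG.
by rewrite wx.
Qed.

(** Adding [x] to [B] puts the types found for it above members of [A], as the order on arrows
    requires of the domain. *)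
Lemma lifts_abs (G : kctx Q) x M k1 k2 (A : {set qual Q k1}) (s : qual Q k2) :
  x \notin domf G -> lifts G.[x <- kinter A] M s ->
  lifts G (abs x M) (qual_arr A s).
Proof.
move=> xG L B.
have [h [t [[hP tP] d]]] := L (fun v => (v == x) || B v).
have [rx bx] : refines (PInter (h x)) k1 /\ bounded true (collapse (PInter (h x)) k1) A.
  by have := hP x (kinter A); rewrite fnd_setf eqxx /= => /(_ erefl).
exists h, (PArr (PInter (h x)) t); split; last first.
  by apply: q_arrR => //; rewrite kkinds_set ictx_set in d.
split.
  move=> y p e; have := hP y p; rewrite fnd_setf.
  case: eqVneq => [yx|_]; last by apply.
  by rewrite -yx (fnd_dom e) in xG.
case: tP => rt lt [s' et le].
split=> //; first by apply: ref_arr => //; inversion rx.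
exists (collapse (PInter (h x)) k1, s').
  by apply/setP => -[C e]; rewrite collapse_arr et !inE xpair_eqE.
rewrite /= le; apply/forall_inP => i /bx[j jA lej].
by apply/exists_inP; exists j.
Qed.

(** The two forms depend on each other: function parts of applications use the cut form, arguments
    and bodies of abstractions the other. *)
Lemma kder_lifts (G : kctx Q) t k (s : qual Q k) :
  kder G t s ->
  (lnf (kkinds G) t k -> lifts G t s) * (neu (kkinds G) t k -> lifts_cut G t s).
Proof.
elim=> {G t k s} [G x k A s xG sA|G M N k1 k2 A s kM IHM stN kN IHN
  |G x M k1 k2 A s xG kM IHM].
- have cut : lifts_cut G.[x <- kinter A] (FVar x) s.
    by apply: lifts_cut_var sA; rewrite fnd_setf eqxx.
  split=> // /lnf_not_lam[//|ek _]; move: s sA cut; subst k => s _.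
  exact: lifts_of_cut.
- have cut : neu (kkinds G) (App M N) k2 -> lifts_cut G (App M N) s.
    move=> /(neu_app_inv (kder_styped kM))[nM lN].
    by apply: lifts_cut_app stN (IHM.2 nM) _ => t tA; apply: (IHN t tA).1.
  split=> // /lnf_not_lam[//|ek]; move: s {kM IHM} cut; subst k2 => s cut /cut.
  exact: lifts_of_cut.
- split=> [ln|ne]; last by exfalso; inversion ne.
  apply: lifts_abs => //; apply: IHM.1; rewrite kkinds_set.
  exact: lnf_abs_inv (styped_lc (kder_styped kM)) ln.
Qed.

End Completeness.

Theorem theorem1 (Q : finType) :
  (forall (G : qctx Q) (t : term) (s : pty Q) (k : sty),
     lnf (kinds G) t k ->
     refines s k ->
     qder G t s k ->
     kder_inter (collapse_ctx G) t (collapse s k))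
  *
  (forall (G : kctx Q) (t : term) (k : sty) (s : qual Q k),
     lnf (kkinds G) t k ->
     kder G t s ->
     {hG : nat -> pty Q & {hs : pty Q &
       ((forall (x : nat) (k' : sty) (A : {set qual Q k'}),
           G.[? x]%fmap = Some (kinter A) ->
           refines (hG x) k' /\ inter_le (collapse (hG x) k') A) *
        (refines hs k /\ linear hs /\
         exists2 s' : qual Q k,
           collapse hs k = [set s'] & qual_le s' s) *
        qder (mkctx (kkinds G) hG) t hs k)%type}}).
Proof.
split=> [G t s k _ _|G t k s ln kd]; first exact: qder_sound.
(* No variable of [G] is abstracted in [t], hence [pred0]: all of them are approximated from
   below. *)
have [h [hs [[hP [rs ls es]] d]]] := (kder_lifts kd).1 ln pred0.
exists (fun x => PInter (h x)), hs; split=> //; split=> // x k' A /hP[rx bx].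
split=> //; apply/forall_inP => i /bx[j jA le].
by apply/exists_inP; exists j.
Qed.
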